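(* Let $K$ be an algebraically closed field, let $\varepsilon$ be a primitive cube root of $1$ if $\operatorname{char}K\neq 3$ and $\varepsilon=1$ if $\operatorname{char}K=3$, and let $p\in K\langle x_1,\dots,x_m\rangle$ be multilinear. Suppose there exist $\alpha,\beta,\gamma\in K$ with $\alpha+\beta+\gamma\neq0$, $\alpha+\beta\varepsilon+\gamma\varepsilon^2\neq0$, $\alpha+\beta\varepsilon^2+\gamma\varepsilon\neq0$, and matrix units $e_1,\dots,e_m\in M_3(K)$ such that $p(e_1,\dots,e_m)$ has eigenvalues $\alpha,\beta,\gamma$. Then $\operatorname{Im} p$ (evaluated on $M_3(K)$) is Zariski dense in $M_3(K)$.
   Context: A polynomial is multilinear if it has the form $\sum_{\sigma\in S_m}c_\sigma x_{\sigma(1)}\cdots x_{\sigma(m)}$. Matrix units are the matrices $e_{i,j}$ with $1$ in position $(i,j)$ and $0$ elsewhere. *)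

(* Defs.v *)
From HB Require Import structures.
From mathcomp Require Import all_boot all_order all_algebra all_fingroup.
Set Implicit Arguments. Unset Strict Implicit. Unset Printing Implicit Defensive.
Import GRing.Theory.
Local Open Scope ring_scope.

(* A multilinear polynomial p = \sum_{sigma in S_m} c_sigma x_{sigma(1)}...x_{sigma(m)}
   in K<x_1..x_m> is given by its coefficient family c : {perm 'I_m} -> K. *)
Definition mlp_eval (K : fieldType) (m n : nat) (c : {perm 'I_m} -> K)
  (A : 'I_m -> 'M[K]_n.+1) : 'M[K]_n.+1 :=
  \sum_(s : {perm 'I_m}) c s *: \prod_(i < m) A (s i).

Definition mlp_image (K : fieldType) (m n : nat) (c : {perm 'I_m} -> K)
  (B : 'M[K]_n.+1) : Prop := exists A : 'I_m -> 'M[K]_n.+1, B = mlp_eval c A.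

Inductive cpexpr (R : Type) (V : Type) : Type :=
| PX of V
| PC of R
| PAdd of cpexpr R V & cpexpr R V
| PMul of cpexpr R V & cpexpr R V.

Fixpoint cpeval (R : ringType) (V : Type) (s : V -> R) (f : cpexpr R V) : R :=
  match f with
  | PX v => s v
  | PC c => c
  | PAdd f g => cpeval s f + cpeval s g
  | PMul f g => cpeval s f * cpeval s g
  end.

Definition zariski_dense (K : fieldType) (k : nat) (S : 'M[K]_k -> Prop) : Prop :=
  forall f : cpexpr K ('I_k * 'I_k),
    (forall A, S A -> cpeval (fun ij => A ij.1 ij.2) f = 0) ->
    forall A, cpeval (fun ij => A ij.1 ij.2) f = 0.

(* Main.v *)
Require Import Defs.
From HB Require Import structures.
From mathcomp Require Import all_boot all_order all_algebra all_fingroup.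
From mathcomp Require Import ring.
Import GRing.Theory.
Local Open Scope ring_scope.

(** Put the matrix unit [e_{i,j}] in the class [j - i] of the grading of [M_3(K)] by [Z/3]. Since
    [alpha + beta + gamma != 0], the matrix [p(e_1, ..., e_m)] has nonzero trace, so the degrees of
    the [e_i] add up to 0 and [p] maps tuples of homogeneous matrices of these degrees to diagonal
    matrices. This gives a multilinear map [phi] to [K^3], equivariant under the cyclic shift.
    Its value at the [e_i] is a permutation of [(alpha, beta, gamma)], whose circulant determinant
    is, up to sign, the product of the three nonzero linear forms; so the image of [phi] spans [K^3].

    A multilinear map to [K^3] with spanning image is dominant. If fixing all arguments but one
    always gave a map of rank at most 1, the image would lie in a line. Otherwise the image
    contains a plane, of equation [z = 0] say, and a point off it. If a polynomial [F != 0]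
    vanishes on the image, write [F = z^k G] with [z] not dividing [G]; the image being covered by
    polynomial curves, [G] vanishes on it too, hence on the plane [z = 0], a contradiction.

    Conjugating, the closure of the image of [p] contains all diagonalizable matrices, which are
    dense in [M_3(K)]. *)

(** * Triangular form and density of the diagonalizable matrices *)

(** Complete a left eigenvector to a basis: the first row becomes [(a, 0, ..., 0)], and induction
    handles the lower right block. *)
Lemma closed_trigonalizable (K : closedFieldType) n (A : 'M[K]_n) :
  exists P T : 'M[K]_n, [/\ P \in unitmx, is_trig_mx T & P *m A = T *m P].
Proof.
elim: n => [|n IHn] in A *.
  exists 1%:M, A; rewrite unitmx1 mul1mx mulmx1; split=> //.
  by apply/is_trig_mxP => -[].
have /closed_rootP[a] : size (char_poly A) != 1 by rewrite size_char_poly.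
rewrite -eigenvalue_root_char => /eigenvalueP[v vA v0].
pose S := row_ebase v : 'M_(1 + n).
(* [v] has rank 1, hence is a multiple of the first row of [S], which is then an eigenvector too. *)
have vS : v = col_ebase v 0 0 *: usubmx S.
  rewrite -{1}(mulmx_ebase v) [col_ebase v in LHS]mx11_scalar.
  rewrite rank_rV v0 -mulmxA mul_scalar_mx; congr (_ *: _).
  apply/rowP => j; rewrite !mxE (bigD1 ord0) //= big1 ?addr0.
    by rewrite !mxE /= mul1r (_ : lshift n 0 = ord0) //; apply: val_inj.
  by move=> k nk; rewrite !mxE /= (_ : (0 == k :> nat) = false) ?mul0r // eq_sym; apply: negbTE.
pose B := S *m A *m invmx S : 'M_(1 + n).
have SU : S \in unitmx by exact: row_ebase_unit.
have uS : usubmx S *m A = a *: usubmx S.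
  have c0 : col_ebase v 0 0 != 0 by apply: contraNneq v0 => c0; rewrite vS c0 scale0r.
  by apply: (scalerI c0); rewrite scalemxAl -vS vA {1}vS !scalerA mulrC.
have uB : usubmx B = a *: row_mx 1%:M 0.
  rewrite /B -mulmxA -mul_usub_mx mulmxA uS -scalemxAl mul_usub_mx mulmxV //.
  by rewrite scalar_mx_block /block_mx col_mxKu.
have [P' [T' [P'U T'T P'T']]] := IHn (drsubmx B).
exists (block_mx 1%:M 0 0 P' *m S), (block_mx a%:M 0 (P' *m dlsubmx B) T'); split.
- by rewrite unitmx_mul SU andbT unitmxE (@det_ublock K 1 n) det1 mul1r -unitmxE.
- by rewrite (@is_trig_block_mx K 1 n 1 n) ?eqxx ?mx11_is_trig.
have -> : block_mx 1%:M 0 0 P' *m S *m A = block_mx 1%:M 0 0 P' *m B *m S.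
  by rewrite /B !mulmxA mulmxKV.
rewrite [RHS]mulmxA; congr (mulmx _ S).
rewrite -[B in LHS]submxK /ulsubmx /ursubmx uB scale_row_mx row_mxKl row_mxKr scaler0.
by rewrite !(@mulmx_block K 1 n 1 n 1 n) !(mulmx1, mul1mx, mulmx0, mul0mx, addr0, add0r) P'T' scalemx1.
Qed.

(** Turns a syntactic expression into an element of a polynomial ring, where degrees and roots make
    sense; [ev t] are the evaluations, [iota] embeds the constants. *)
Lemma cpeval_lift (R A : comNzRingType) (T V : Type) (ev : T -> {rmorphism A -> R})
    (iota : R -> A) (s : V -> A) (f : cpexpr R V) :
    (forall t a, ev t (iota a) = a) ->
  exists q, forall t, ev t q = cpeval (fun v => ev t (s v)) f.
Proof.
move=> evK; elim: f => [v|a|f [p pE] g [q qE]|f [p pE] g [q qE]] /=.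
- by exists (s v).
- by exists (iota a) => t; rewrite evK.
- by exists (p + q) => t; rewrite rmorphD pE qE.
- by exists (p * q) => t; rewrite rmorphM pE qE.
Qed.

Lemma eq_cpeval (R : nzRingType) (V : Type) (s1 s2 : V -> R) (f : cpexpr R V) :
  s1 =1 s2 -> cpeval s1 f = cpeval s2 f.
Proof. by move=> s12; elim: f => //= f -> g ->. Qed.

Lemma closed_injective (K : closedFieldType) n : exists d : 'I_n -> K, injective d.
Proof.
have [s sn us] : exists2 s : seq K, size s = n & uniq s.
  elim: n => [|n [s sn us]]; first by exists [::].
  have /closed_nonrootP[x] : \prod_(y <- s) ('X - y%:P) != 0 :> {poly K}.
    by rewrite monic_neq0 // monic_prod_XsubC.
  by rewrite root_prod_XsubC => xs; exists (x :: s); rewrite /= ?sn ?xs.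
exists (fun i => s`_i) => i j /eqP.
by rewrite nth_uniq ?sn ?ltn_ord // => /eqP/val_inj.
Qed.

Lemma trig_diagonalizable (K : fieldType) n (T : 'M[K]_n.+1) :
  is_trig_mx T -> injective (fun i => T i i) -> diagonalizable T.
Proof.
move=> Ttrig Tinj; apply/diagonalizableP.
exists [seq T i i | i <- enum 'I_n.+1]; first by rewrite map_inj_uniq ?enum_uniq.
by rewrite big_map big_enum -char_poly_trig // mxminpoly_dvd_char.
Qed.

(** All but finitely many matrices on a suitable line through [A] have distinct eigenvalues. The
    restriction of [f] to this line is a polynomial with infinitely many zeros, so it also vanishes
    at [A]. *)
Lemma eq0_of_diagonalizable (K : closedFieldType) n (f : cpexpr K ('I_n.+1 * 'I_n.+1)) :
    (forall (P : 'M[K]_n.+1) d, P \in unitmx ->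
      cpeval (fun ij => (invmx P *m diag_mx d *m P) ij.1 ij.2) f = 0) ->
  forall A : 'M[K]_n.+1, cpeval (fun ij => A ij.1 ij.2) f = 0.
Proof.
move=> f0 A; have [P [T [PU Ttrig PT]]] := closed_trigonalizable K _ A.
have [d dinj] := closed_injective K n.+1.
pose D := diag_mx (\row_i d i); pose B := invmx P *m D *m P.
have [|q qE] := @cpeval_lift K {poly K} K _ (fun t => horner_eval t) polyC
  (fun ij => (A ij.1 ij.2)%:P + B ij.1 ij.2 *: 'X) f.
  by move=> t a; rewrite /= horner_evalE hornerC.
apply/eqP; apply: contraT => fA0.
(* [A + t B] is similar to [T + t D], whose diagonal entries are distinct unless [disc] vanishes
   at [t]. *)
pose disc := \prod_i \prod_(j | j != i) ((T i i - T j j)%:P + (d i - d j) *: 'X).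
have disc0 : disc != 0.
  apply/prodf_neq0 => i _; apply/prodf_neq0 => j ji.
  apply: contraNneq ji => /(congr1 (coefp 1%N)).
  rewrite /= coefD coefC coefZ coefX coef0 mulr1 add0r => /eqP.
  by rewrite subr_eq0 => /eqP/dinj->.
have q0 : q != 0.
  apply: contraNneq fA0 => q0; have := qE 0; rewrite q0 /= horner_evalE horner0 => ->.
  by apply/eqP/eq_cpeval => ij; rewrite !horner_evalE !hornerE.
have /closed_nonrootP[t] : q * disc != 0 by rewrite mulf_neq0.
rewrite rootM negb_or => /andP[qt disct]; case/negP: qt; apply/eqP.
have PM : P *m (A + t *: B) = (T + t *: D) *m P.
  by rewrite mulmxDr PT mulmxDl -scalemxAr -scalemxAl /B !mulmxA mulmxV // mul1mx.
have [R RU /(diagonalizable_forLR RU)[c TE]] : diagonalizable (T + t *: D).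
  apply: trig_diagonalizable => [|i j /eqP].
    apply/is_trig_mxP => i j ij; rewrite !mxE (is_trig_mxP Ttrig) // add0r.
    by rewrite (_ : (i == j) = false) ?mulr0 // -val_eqE ltn_eqF.
  rewrite !mxE !eqxx !mulr1n => /eqP eqij; apply/eqP; rewrite eq_sym.
  apply: contraNT disct => ji; rewrite /disc (bigD1 i) //= (bigD1 j) //= !rootM.
  rewrite [root (_ + _) _](_ : _ = true) // /root !hornerE mulrBl.
  by rewrite addrACA -opprD subr_eq0 !(mulrC _ t) eqij eqxx.
have ME : A + t *: B = invmx (R *m P) *m diag_mx c *m (R *m P).
  apply: (can_inj (mulKmx PU)); rewrite PM TE mxpoly.conjVmx // (_ : invmx (R *m P) = invmx P *m invmx R).
    by rewrite !mulmxA mulmxV // mul1mx.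
  exact: invrM.
have := qE t; rewrite /= horner_evalE => ->.
rewrite -[RHS](f0 (R *m P) c) ?unitmx_mul ?RU // -ME.
by apply/eq_cpeval => ij; rewrite !horner_evalE !hornerE !mxE mulrC.
Qed.

(** * Polynomials vanishing on a plane and on curves leaving it *)

Lemma bipoly_neq0 (K : closedFieldType) (p : {poly {poly K}}) :
  p != 0 -> exists a b, p.[b%:P].[a] != 0.
Proof.
move=> p0; have /closed_nonrootP[a pa] : lead_coef p != 0 by rewrite lead_coef_eq0.
have : map_poly (horner_eval a) p != 0.
  by apply: contraNneq pa => /(congr1 (coefp (size p).-1)); rewrite /= coef_map coef0 => /eqP.
case/closed_nonrootP => b pb; exists a, b; apply: contraNneq pb => pab.
by apply/eqP; rewrite -[b](hornerC b a) horner_map /= horner_evalE.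
Qed.

(** The outermost variable is the third coordinate, so that divisibility by it is read off from the
    root 0. *)
Definition eval3 (K : fieldType) (u : 'rV[K]_3) : {rmorphism {poly {poly {poly K}}} -> K} :=
  horner_eval (u 0 0) \o horner_eval (u 0 1)%:P \o horner_eval (u 0 ord_max)%:P%:P.

Lemma eval3_curve (K : fieldType) (q : 'rV[{poly K}]_3) (G : {poly {poly {poly K}}}) :
  exists g : {poly K}, forall t, g.[t] = eval3 _ (map_mx (horner_eval t) q) G.
Proof.
elim/poly_ind: G => [|G p [g gE]]; first by exists 0 => t; rewrite rmorph0 horner0.
have [h hE] : exists h : {poly K}, forall t, h.[t] = p.[(q 0 1).[t]%:P].[(q 0 0).[t]].
  elim/poly_ind: p => [|p c [h hE]]; first by exists 0 => t; rewrite !horner0.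
  exists (h * q 0 1 + (c \Po q 0 0)) => t.
  by rewrite !hornerE horner_comp hE.
exists (g * q 0 ord_max + h) => t.
rewrite !hornerE gE hE /= !mxE /= !horner_evalE !hornerE //.
Qed.

(** Stands in for irreducibility: over an infinite field, a product of polynomials vanishing along
    such a curve has a factor vanishing along it. *)
Definition curve_connected {K : fieldType} {n} (S : 'rV[K]_n -> Prop) :=
  forall u v, S u -> S v -> exists q : 'rV[{poly K}]_n,
    [/\ map_mx (horner_eval 0) q = u, map_mx (horner_eval 1) q = v
      & forall t, S (map_mx (horner_eval t) q)].

(** Join a point of the plane where [G] is nonzero to [u1], where the third coordinate is nonzero:
    neither factor of [F] vanishes identically on this curve. The linear forms [L] leave room for
    changes of coordinates. *)
Lemma eq0_of_coord_plane (K : closedFieldType) (S : 'rV[K]_3 -> Prop) (T : Type)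
    (L : T -> 'cV[K]_3) (f : cpexpr K T) :
    curve_connected S ->
    (forall u : 'rV_3, u 0 ord_max = 0 -> S u) -> (exists2 u : 'rV_3, S u & u 0 ord_max != 0) ->
    (forall u : 'rV_3, S u -> cpeval (fun v => (u *m L v) 0 0) f = 0) ->
  forall u : 'rV_3, cpeval (fun v => (u *m L v) 0 0) f = 0.
Proof.
move=> Sconn Splane [u1 Su1 u1n0] f0 u; apply/eqP; apply: contraT => fu.
pose X (k : 'I_3) : {poly {poly {poly K}}} :=
  if k == 0 then 'X%:P%:P else if k == 1 then 'X%:P else 'X.
have XE w k : eval3 _ w (X k) = w 0 k.
  rewrite /= /X !horner_evalE; case: k => [[|[|[|//]]] ik] /=; rewrite !hornerE;
    by congr (w _ _); apply: val_inj.
have [|F FE] := @cpeval_lift K _ _ _ (@eval3 K) (fun a => a%:P%:P%:P)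
  (fun v => \sum_k X k * (L v k 0)%:P%:P%:P) f.
  by move=> w a; rewrite /= !horner_evalE !hornerC.
have {}FE w : eval3 _ w F = cpeval (fun v => (w *m L v) 0 0) f.
  rewrite FE; apply: eq_cpeval => v; rewrite mxE rmorph_sum; apply: eq_bigr => k _.
  by rewrite rmorphM XE /= !horner_evalE !hornerC.
have F0 : F != 0 by apply: contraNneq fu => F0; rewrite -FE F0 rmorph0.
have [m [G]] := multiplicity_XsubC F 0; rewrite F0 subr0 => /= G0 FG.
(* [G0] says that [G.[0]], the restriction of [G] to the plane, is a nonzero polynomial in two
   variables. *)
have [a [b Gab]] := bipoly_neq0 _ _ G0.
pose u0 : 'rV[K]_3 := \row_k (if k == 0 then a else if k == 1 then b else 0).
have Su0 : S u0 by apply: Splane; rewrite mxE.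
have [q [q0 q1 qS]] := Sconn _ _ Su0 Su1.
have [g gE] := eval3_curve _ q G.
have g0 : g != 0.
  by apply: contraNneq Gab => g0; have := gE 0; rewrite q0 g0 horner0 /= !horner_evalE !mxE /= => ->.
have c0 : q 0 ord_max != 0.
  by apply: contraNneq u1n0 => c0; rewrite -q1 mxE c0 horner_evalE horner0.
have /closed_nonrootP[t] : g * q 0 ord_max ^+ m != 0 by rewrite mulf_neq0 ?expf_neq0.
case/negP; apply/eqP; rewrite hornerM horner_exp gE.
rewrite -[RHS](f0 _ (qS t)) -FE FG rmorphM rmorphXn /=.
by rewrite !mxE /= !horner_evalE !hornerE.
Qed.

(** In the basis given by the rows of [H] and [v], the plane is where the third coordinate
    vanishes. *)
Lemma eq0_of_plane (K : closedFieldType) (S : 'rV[K]_3 -> Prop) (T : Type)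
    (L : T -> 'cV[K]_3) (f : cpexpr K T) (H : 'M[K]_(2, 3)) (v : 'rV[K]_3) :
    curve_connected S -> row_free (col_mx H v) ->
    (forall h : 'rV_2, S (h *m H)) -> S v ->
    (forall w : 'rV_3, S w -> cpeval (fun v => (w *m L v) 0 0) f = 0) ->
  forall w : 'rV_3, cpeval (fun v => (w *m L v) 0 0) f = 0.
Proof.
rewrite row_free_unit; set N := (col_mx H v : 'M_3) => Sconn NU SH Sv f0 w.
have E u : cpeval (fun t => (u *m N *m L t) 0 0) f = cpeval (fun t => (u *m (N *m L t)) 0 0) f.
  by apply: eq_cpeval => t; rewrite mulmxA.
rewrite -[w](mulmxKV NU) E; apply: (@eq0_of_coord_plane _ (fun u => S (u *m N))).
- move=> u1 u2 Su1 Su2; have [q [q0 q1 qS]] := Sconn _ _ Su1 Su2.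
  have mapN (t : K) : map_mx (horner_eval t) (q *m map_mx polyC (invmx N)) =
      map_mx (horner_eval t) q *m invmx N.
    rewrite map_mxM -map_mx_comp; congr (_ *m _).
    by apply/matrixP => i j; rewrite !mxE /= horner_evalE hornerC.
  exists (q *m map_mx polyC (invmx N)); rewrite !mapN q0 q1 !mulmxK //; split=> // t.
  by rewrite mapN mulmxKV.
- move=> u u0; rewrite -[u](@hsubmxK K 1 2 1) /N (@mul_row_col K 1 2 1 3).
  rewrite [rsubmx _]mx11_scalar mxE (_ : rshift 2 0 = ord_max); last exact: val_inj.
  by rewrite u0 raddf0 mul0mx addr0.
- exists (row_mx 0 1 : 'M_(1, 2 + 1)); first by rewrite /N (@mul_row_col K 1 2 1 3) mul0mx add0r mul1mx.
  rewrite (_ : ord_max = rshift 2 0); last exact: val_inj.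
  by rewrite (@row_mxEr K 1 2 1) mxE oner_eq0.
- by move=> u Su; rewrite -E f0.
Qed.

(** * Multilinear maps and their images *)

Definition upd {I : finType} {V : Type} (x : {ffun I -> V}) (i : I) (u : V) : {ffun I -> V} :=
  [ffun j => if j == i then u else x j].

Definition multilinear {K : fieldType} {I : finType} {V W : lmodType K}
    (phi : {ffun I -> V} -> W) :=
  forall x i a u v, phi (upd x i (a *: u + v)) = a *: phi (upd x i u) + phi (upd x i v).

Lemma upd_id (I : finType) (V : Type) (x : {ffun I -> V}) i : upd x i (x i) = x.
Proof. by apply/ffunP => j; rewrite ffunE; case: eqP => // ->. Qed.

Lemma multilinearD (K : fieldType) (I : finType) (V W : lmodType K)
    (phi : {ffun I -> V} -> W) x i u v :
  multilinear phi -> phi (upd x i (u + v)) = phi (upd x i u) + phi (upd x i v).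
Proof. by move=> /(_ x i 1 u v); rewrite !scale1r. Qed.

Lemma multilinear0 (K : fieldType) (I : finType) (V W : lmodType K)
    (phi : {ffun I -> V} -> W) x i :
  multilinear phi -> phi (upd x i 0) = 0.
Proof. by move=> /(_ x i (-1) 0 0); rewrite !scaleN1r !addNr. Qed.

(** The parameter is switched on in one argument at a time, along a list of places. *)
Lemma multilinear_curve (K : fieldType) (I : finType) (V : lmodType K) n
    (phi : {ffun I -> V} -> 'rV[K]_n) (x d : {ffun I -> V}) :
    multilinear phi ->
  exists q : 'rV[{poly K}]_n, forall t,
    map_mx (horner_eval t) q = phi [ffun i => t *: d i + x i].
Proof.
move=> phiL.
suff /(_ (enum I) x)[q qE] : forall (s : seq I) (x : {ffun I -> V}), exists q : 'rV[{poly K}]_n, forall t,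
    map_mx (horner_eval t) q = phi [ffun i => if i \in s then t *: d i + x i else x i].
  by exists q => t; rewrite qE; congr phi; apply/ffunP => i; rewrite !ffunE mem_enum.
elim=> [|i s IHs] {}x.
  exists (map_mx polyC (phi x)) => t.
  rewrite -map_mx_comp; transitivity (phi x).
    by apply/matrixP => j k; rewrite mxE /= horner_evalE hornerC.
  by congr phi; apply/ffunP => j; rewrite !ffunE.
have [is_|is_] := boolP (i \in s).
  have [q qE] := IHs x; exists q => t; rewrite qE; congr phi.
  by apply/ffunP => j; rewrite !ffunE inE; case: eqP => // ->; rewrite is_.
have [q qE] := IHs x; have [r rE] := IHs (upd x i (d i)).
exists ('X *: r + q) => t.
have -> : map_mx (horner_eval t) ('X *: r + q) =
    t *: map_mx (horner_eval t) r + map_mx (horner_eval t) q.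
  by apply/matrixP => j k; rewrite !mxE !horner_evalE !hornerE.
rewrite qE rE; pose y := [ffun j => if j \in s then t *: d j + x j else x j].
transitivity (phi (upd y i (t *: d i + x i))); last first.
  by congr phi; apply/ffunP => j; rewrite !ffunE inE; case: eqP => [->|].
rewrite phiL; congr (_ *: phi _ + phi _); apply/ffunP => j; rewrite !ffunE.
  by case: eqP => [->|//]; rewrite (negPf is_).
by case: eqP => [->|//]; rewrite (negPf is_).
Qed.

Lemma multilinear_curve_connected (K : fieldType) (I : finType) (V : lmodType K) n
    (phi : {ffun I -> V} -> 'rV[K]_n) :
  multilinear phi -> curve_connected (fun w => exists x, w = phi x).
Proof.
move=> phiL _ _ [x ->] [y ->]; have [q qE] := multilinear_curve _ _ _ _ _ x (y - x) phiL.
exists q; split=> [||t]; rewrite qE; last by eexists.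
  by congr phi; apply/ffunP => i; rewrite !ffunE scale0r add0r.
by congr phi; apply/ffunP => i; rewrite !ffunE scale1r subrK.
Qed.

(* If [x i != y i], one of [x i], [y i], [x i + y i] can replace both [x i] and [y i] without
   killing [phi x] or [phi y]; then [x] and [y] differ at one place less. *)
Lemma multilinear_rank1 (K : fieldType) (I : finType) (V : lmodType K) n
    (phi : {ffun I -> V} -> 'rV[K]_n) :
    multilinear phi ->
    (forall x i u, phi x != 0 -> (phi (upd x i u) <= phi x)%MS) ->
  forall x y, phi x != 0 -> (phi y <= phi x)%MS.
Proof.
move=> phiL phi1 x y; have [-> | ] := eqVneq (phi y) 0; first by rewrite sub0mx.
have [s] : exists s : seq I, forall i, x i != y i -> i \in s.
  by exists (enum I) => i; rewrite mem_enum.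
elim: s => [|i s IHs] in x y *.
  move=> xy _ _; suff -> : x = y by [].
  by apply/ffunP => i; apply/eqP; apply: contraT => /xy.
move=> xy y0 x0.
have [u xu yu] : exists2 u, phi (upd x i u) != 0 & phi (upd y i u) != 0.
  have [xyi|] := eqVneq (phi (upd x i (y i))) 0; last by exists (y i); rewrite ?upd_id.
  have [yxi|] := eqVneq (phi (upd y i (x i))) 0; last by exists (x i); rewrite ?upd_id.
  exists (x i + y i); rewrite multilinearD // upd_id ?xyi ?yxi ?addr0 ?add0r //.
have yuy : (phi y <= phi (upd y i u))%MS.
  by have := phi1 _ i (y i) yu; congr (phi _ <= _)%MS; apply/ffunP => j;
    rewrite !ffunE; case: eqP => // ->.
(* The chain runs from [phi y] through [phi (upd y i u)] and [phi (upd x i u)] to [phi x]; the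
   induction hypothesis gives its middle link. *)
apply: submx_trans yuy (submx_trans _ (phi1 _ i u x0)); apply: IHs => // j.
by rewrite !ffunE; case: ifP => [|ji /xy]; rewrite ?eqxx // inE ji.
Qed.

Lemma row_free_col_mx_row (K : fieldType) m n (A : 'M[K]_(m, n)) (v : 'rV[K]_n) :
  row_free A -> ~~ (v <= A)%MS -> row_free (col_mx A v).
Proof.
move=> /eqP Afree vA; have : (A < col_mx A v)%MS.
  by rewrite ltmxE col_mx_sub submx_refl (negPf vA) andbT -addsmxE addsmxSl.
rewrite ltmxErank Afree => /andP[_ ltm].
by rewrite /row_free eqn_leq rank_leq_row (leq_trans _ ltm) // addn1.
Qed.

Lemma eq0_of_multilinear (K : closedFieldType) (I : finType) (V : lmodType K)
    (phi : {ffun I -> V} -> 'rV[K]_3) (T : Type) (L : T -> 'cV[K]_3) (f : cpexpr K T) :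
    multilinear phi ->
    (forall m (H : 'M[K]_(m, 3)), (forall x, (phi x <= H)%MS) -> row_full H) ->
    (forall x, cpeval (fun v => (phi x *m L v) 0 0) f = 0) ->
  forall w : 'rV_3, cpeval (fun v => (w *m L v) 0 0) f = 0.
Proof.
move=> phiL phi_full f0 w; apply/eqP; apply: contraT => fw.
(* Used with [m] equal to 2, 1 and 0, where [3 <= m] computes to [false]. *)
have rank_le m (H : 'M[K]_(m, 3)) : (forall x, phi x <= H)%MS -> (3 <= m)%N.
  by move=> /phi_full/eqP <-; apply: rank_leq_row.
have phi1 x i u : phi x != 0 -> (phi (upd x i u) <= phi x)%MS.
  move=> x0; apply: contraT => xu; pose H := (col_mx (phi x) (phi (upd x i u)) : 'M_(2, 3)).
  have Hfree : row_free H by apply: (row_free_col_mx_row K 1 3) => //; rewrite /row_free rank_rV x0.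
  apply: (rank_le 2 H) => y; apply: contraT => yH; apply: contraNT fw => _; apply/eqP.
  apply: (@eq0_of_plane K _ T L f H (phi y) (multilinear_curve_connected _ _ _ _ _ phiL)).
  - exact: (row_free_col_mx_row K 2 3).
  (* The final [+ 0] lets [multilinear] apply to both summands; the leftover term is killed by
     [multilinear0]. *)
  - move=> h; exists (upd x i (h 0 ord_max *: u + (h 0 0 *: x i + 0))).
    rewrite !phiL upd_id multilinear0 // addr0 addrC.
    rewrite -[h in LHS](@hsubmxK K 1 1 1) /H (@mul_row_col K 1 1 1 3).
    rewrite [lsubmx _]mx11_scalar [rsubmx _]mx11_scalar !mul_scalar_mx !mxE.
    by congr (h _ _ *: _ + h _ _ *: _); apply: val_inj.
  - by exists y.
  - by move=> _ [z ->].
apply: (rank_le 0 0) => x; apply: contraT => x0.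
have {}x0 : phi x != 0 by apply: contraNneq x0 => ->; rewrite sub0mx.
by have /rank_le : forall y, (phi y <= phi x)%MS by move=> y; apply: multilinear_rank1.
Qed.

(** * Linearity and equivariance of polynomial evaluation *)

Lemma prod_linear (K : fieldType) (R : algType K) (I : eqType) (s : seq I) (F G H : I -> R) i a :
    uniq s -> i \in s -> F i = a *: G i + H i ->
    (forall j, j != i -> F j = G j /\ F j = H j) ->
  \prod_(j <- s) F j = a *: \prod_(j <- s) G j + \prod_(j <- s) H j.
Proof.
move=> + + Fi Fj; elim: s => //= k s IHs /andP[ks us]; rewrite inE !big_cons.
have [ik _|ik /= is_] := eqVneq i k; last first.
  have [<- <-] : F k = G k /\ F k = H k by apply: Fj; rewrite eq_sym.
  by rewrite IHs // mulrDr -scalerAr.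
rewrite -ik in ks *; have tail E : (forall j, j != i -> F j = E j) ->
    \prod_(j <- s) F j = \prod_(j <- s) E j.
  by move=> FE; apply: eq_big_seq => j js; apply: FE; apply: contraNneq ks => <-.
by rewrite Fi mulrDl scalerAl -(tail G) -?(tail H) // => j /Fj[].
Qed.

Lemma eq_mlp_eval (K : fieldType) m n (c : {perm 'I_m} -> K) (A B : 'I_m -> 'M[K]_n.+1) :
  A =1 B -> mlp_eval c A = mlp_eval c B.
Proof. by move=> AB; apply: eq_bigr => s _; congr (_ *: _); apply: eq_bigr => i _. Qed.

Lemma mlp_eval_linear (K : fieldType) m n (c : {perm 'I_m} -> K) (A B C : 'I_m -> 'M[K]_n.+1) i a :
    A i = a *: B i + C i -> (forall j, j != i -> A j = B j /\ A j = C j) ->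
  mlp_eval c A = a *: mlp_eval c B + mlp_eval c C.
Proof.
move=> Ai Aj; rewrite /mlp_eval scaler_sumr -big_split; apply: eq_bigr => s _ /=.
(* In the monomial of [s], the variable of index [i] stands at place [s^-1 i] only. *)
rewrite (@prod_linear K _ _ _ _ (fun j => B (s j)) (fun j => C (s j)) ((s^-1)%g i) a) //.
- by rewrite scalerDr !scalerA mulrC.
- by rewrite index_enum_uniq.
- by rewrite permKV.
- by move=> j ji; apply: Aj; apply: contraNneq ji => <-; rewrite permK.
Qed.

Lemma mlp_eval_morph (K : fieldType) m n (c : {perm 'I_m} -> K) (A : 'I_m -> 'M[K]_n.+1)
    (theta : 'M[K]_n.+1 -> 'M[K]_n.+1) :
    linear theta -> monoid_morphism theta ->
  mlp_eval c (fun i => theta (A i)) = theta (mlp_eval c A).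
Proof.
move=> thetaL [theta1 thetaM].
have thetaD B C : theta (B + C) = theta B + theta C by rewrite -[B]scale1r thetaL !scale1r.
have theta0 : theta 0 = 0 by apply: (addrI (theta 0)); rewrite -thetaD !addr0.
rewrite /mlp_eval (big_morph theta thetaD theta0); apply: eq_bigr => s _.
by rewrite -[_ *: _ in RHS]addr0 thetaL theta0 addr0 (big_morph theta thetaM theta1).
Qed.

(** * The cyclic grading of matrices *)

(** Addition in ['I_n.+1] is modulo [n.+1], so the degree lives in a cyclic group. *)
Definition homog {K : fieldType} {n} (d : 'I_n.+1) (A : 'M[K]_n.+1) :=
  forall i j, j != i + d -> A i j = 0.

Definition homog_mx {K : fieldType} {n} (d : 'I_n.+1) (w : 'rV[K]_n.+1) : 'M[K]_n.+1 :=
  \matrix_(i, j) if j == i + d then w 0 i else 0.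

Lemma homog_mxP (K : fieldType) n (d : 'I_n.+1) (w : 'rV[K]_n.+1) : homog d (homog_mx d w).
Proof. by move=> i j /negPf ji; rewrite mxE ji. Qed.

Lemma homog_prod (K : fieldType) n I (s : seq I) (d : I -> 'I_n.+1) (A : I -> 'M[K]_n.+1) :
  (forall i, homog (d i) (A i)) -> homog (\sum_(i <- s) d i) (\prod_(i <- s) A i).
Proof.
move=> dA; elim: s => [|k s IHs] i j.
  by rewrite !big_nil addr0 mxE eq_sym => /negPf ->.
rewrite !big_cons => ij; rewrite mxE big1 // => l _.
have [lE|/dA->] := eqVneq l (i + d k); last by rewrite mul0r.
by rewrite IHs ?mulr0 // lE -addrA.
Qed.

(** Each monomial uses every argument once, and the degrees commute, so all monomials have the same
    degree. *)
Lemma homog_mlp_eval (K : fieldType) m n (c : {perm 'I_m} -> K) (d : 'I_m -> 'I_n.+1)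
    (A : 'I_m -> 'M[K]_n.+1) :
  (forall i, homog (d i) (A i)) -> homog (\sum_i d i) (mlp_eval c A).
Proof.
move=> dA i j ij; rewrite /mlp_eval summxE big1 // => s _; rewrite mxE.
rewrite (@homog_prod _ _ _ _ (fun k => d (s k))) ?mulr0 //.
by rewrite (reindex_inj (@perm_inj _ s)) in ij.
Qed.

Definition shift_row {K : fieldType} {n} (s : 'I_n.+1) (w : 'rV[K]_n.+1) : 'rV[K]_n.+1 :=
  \row_k w 0 (k + s).

Lemma homog_mx_linear (K : fieldType) n (d : 'I_n.+1) : linear (@homog_mx K n d).
Proof.
by move=> a u v; apply/matrixP => i j; rewrite !mxE; case: ifP; rewrite // mulr0 addr0.
Qed.

Lemma homog_delta_mx (K : fieldType) n (i j : 'I_n.+1) :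
  delta_mx i j = homog_mx (j - i) (delta_mx 0 i) :> 'M[K]_n.+1.
Proof.
apply/matrixP => k l; rewrite !mxE /=.
have [->|ki] := eqVneq k i; first by rewrite addrC subrK; case: eqP.
by rewrite if_same.
Qed.

Lemma homog0_diag_mx (K : fieldType) n (A : 'M[K]_n.+1) :
  homog 0 A -> A = diag_mx (\row_i A i i).
Proof.
move=> A0; apply/matrixP => i j; rewrite !mxE.
by have [<-|ij] := eqVneq i j; rewrite ?mulr1n // A0 // addr0 eq_sym.
Qed.

(** The shift of indices is conjugation by a cyclic permutation matrix. *)
Lemma shift_mx_morph (K : fieldType) n (s : 'I_n.+1) :
  linear (fun A : 'M[K]_n.+1 => \matrix_(i, j) A (i + s) (j + s)) /\
  monoid_morphism (fun A : 'M[K]_n.+1 => \matrix_(i, j) A (i + s) (j + s)).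
Proof.
split=> [a A B|]; first by apply/matrixP => i j; rewrite !mxE.
split=> [|A B]; apply/matrixP => i j; rewrite !mxE ?(inj_eq (addIr _)) //.
by rewrite (reindex_inj (addIr s)); apply: eq_bigr => k _; rewrite !mxE.
Qed.

Lemma conj_mx_morph (K : fieldType) n (P : 'M[K]_n.+1) : P \in unitmx ->
  linear (fun A : 'M[K]_n.+1 => invmx P *m A *m P) /\
  monoid_morphism (fun A : 'M[K]_n.+1 => invmx P *m A *m P).
Proof.
move=> PU; split=> [a A B|]; first by rewrite mulmxDr mulmxDl -scalemxAr -scalemxAl.
split=> [|A B]; first by rewrite mulmx1 mulVmx.
by rewrite -[A * B]/(A *m B) -[RHS]/(mulmx _ _) !mulmxA mulmxK.
Qed.

Lemma shift_homog_mx (K : fieldType) n (s d : 'I_n.+1) (w : 'rV[K]_n.+1) :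
  \matrix_(i, j) homog_mx d w (i + s) (j + s) = homog_mx d (shift_row s w).
Proof.
by apply/matrixP => i j; rewrite !mxE addrAC (inj_eq (addIr _)).
Qed.

(** The map [phi] of the overview, in coordinates on the homogeneous components. It is the whole
    value of the polynomial when the degrees add up to 0. *)
Definition diag_eval {K : fieldType} {m n} (c : {perm 'I_m} -> K) (d : 'I_m -> 'I_n.+1)
    (x : {ffun 'I_m -> 'rV[K]_n.+1}) : 'rV[K]_n.+1 :=
  \row_k mlp_eval c (fun i => homog_mx (d i) (x i)) k k.

Lemma diag_eval_multilinear (K : fieldType) m n (c : {perm 'I_m} -> K) (d : 'I_m -> 'I_n.+1) :
  multilinear (diag_eval c d).
Proof.
move=> x i a u v; apply/rowP => k; rewrite !mxE.
rewrite (@mlp_eval_linear K m n c _ (fun j => homog_mx (d j) (upd x i u j))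
  (fun j => homog_mx (d j) (upd x i v j)) i a) ?mxE //.
  by rewrite !ffunE eqxx homog_mx_linear.
by move=> j /negPf ji; rewrite !ffunE ji.
Qed.

(** Makes every cyclic shift of a value a value again, since shifting indices preserves degrees. *)
Lemma diag_eval_shift (K : fieldType) m n (c : {perm 'I_m} -> K) (d : 'I_m -> 'I_n.+1)
    (s : 'I_n.+1) (x : {ffun 'I_m -> 'rV[K]_n.+1}) :
  diag_eval c d [ffun i => shift_row s (x i)] = shift_row s (diag_eval c d x).
Proof.
apply/rowP => k; rewrite !mxE; have [SL SM] := shift_mx_morph K n s.
have := mlp_eval_morph _ _ _ c (fun i => homog_mx (d i) (x i)) _ SL SM.
move/matrixP/(_ k k); rewrite mxE => <-; congr (fun_of_matrix _ k k).
by apply: eq_mlp_eval => i; rewrite ffunE shift_homog_mx.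
Qed.

(** * Eigenvalues and the circulant determinant *)

Lemma trace_eigenvalues (K : fieldType) (A : 'M[K]_3) a b c :
  char_poly A = \prod_(x <- [:: a; b; c]) ('X - x%:P) -> \tr A = a + b + c.
Proof.
move=> AE; have := char_poly_trace A isT.
rewrite AE (@coefPn_prod_XsubC _ [:: a; b; c]) // => /oppr_inj <-.
by rewrite !big_cons big_nil addr0 addrA.
Qed.

Lemma diag_mx_eigenvalues (K : fieldType) (v : 'rV[K]_3) a b c :
    char_poly (diag_mx v) = \prod_(x <- [:: a; b; c]) ('X - x%:P) ->
  perm_eq [:: v 0 0; v 0 1; v 0 ord_max] [:: a; b; c].
Proof.
rewrite char_poly_trig ?diag_mx_is_trig // => vE; apply: prod_XsubC_eq.
rewrite -vE !big_ord_recl big_ord0 !big_cons big_nil !mxE !eqxx !mulr1n.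
by congr (('X - (v _ _)%:P) * (('X - (v _ _)%:P) * (('X - (v _ _)%:P) * _))); apply: val_inj.
Qed.

(** With [j + i] instead of [j - i], row [i] is [shift_row i v]; for size 3 this changes the sign of
    the usual circulant determinant. *)
Definition circulant {K : fieldType} {n} (v : 'rV[K]_n.+1) : 'M[K]_n.+1 :=
  \matrix_(i, j) v 0 (j + i).

Lemma det_circulant (K : fieldType) (v : 'rV[K]_3) :
  \det (circulant v) = 3%:R * (v 0 0 * v 0 1 * v 0 ord_max)
    - (v 0 0 ^+ 3 + v 0 1 ^+ 3 + v 0 ord_max ^+ 3).
Proof.
(* Indexing by [nat] lets the ordinals produced by the cofactor expansions be computed to 0, 1 or
   2. *)
pose F k : K := v 0 (inord k); have vF k : v 0 k = F k by rewrite /F inord_val.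
rewrite (expand_det_row _ 0) !big_ord_recl big_ord0 /cofactor.
do 2 rewrite !(expand_det_row _ 0) !big_ord_recl !big_ord0 /cofactor.
rewrite !det_mx00 !mxE !vF /=.
repeat match goal with
  | |- context [F ?k] => let r := eval vm_compute in k in progress change (F k) with (F r)
  | |- context [(-1) ^+ ?k] => let r := eval vm_compute in k in progress change k with r
end.
move: (F 0%N) (F 1%N) (F 2%N) => a b c; ring.
Qed.

Lemma sum_cubes_factor (K : fieldType) (eps a b c : K) :
    1 + eps + eps ^+ 2 = 0 ->
  (a + b + c) * (a + b * eps + c * eps ^+ 2) * (a + b * eps ^+ 2 + c * eps) =
  a ^+ 3 + b ^+ 3 + c ^+ 3 - 3%:R * (a * b * c).
Proof.
move=> epsE; have eps2 : eps ^+ 2 = - 1 - eps.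
  by apply/eqP; rewrite -subr_eq0 -epsE; apply/eqP; ring.
(* After [eps2], the last two factors multiply to [a^2 + b^2 + c^2 - ab - bc - ca] minus
   [(b - c)^2 (1 + eps + eps^2)]. *)
transitivity (a ^+ 3 + b ^+ 3 + c ^+ 3 - 3%:R * (a * b * c)
  - (a + b + c) * (b - c) ^+ 2 * (1 + eps + eps ^+ 2)); last by rewrite epsE mulr0 subr0.
by rewrite [in LHS]eps2; ring.
Qed.

(** The one relation on [eps] that the factorization needs, uniform in the characteristic. *)
Lemma cube_root_sum (K : fieldType) (eps : K) :
    (if 3%N \in [pchar K] then eps = 1 else 3.-primitive_root eps) ->
  1 + eps + eps ^+ 2 = 0.
Proof.
case: ifP => [char3 ->|_ epsP].
  by rewrite expr1n -[RHS](pcharf0 char3); ring.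
have eps1 : eps - 1 != 0.
  by rewrite subr_eq0 -[eps]expr1 -(prim_order_dvd epsP).
apply: (mulfI eps1); rewrite mulr0; transitivity (eps ^+ 3 - 1); first by ring.
by rewrite (prim_expr_order epsP) subrr.
Qed.

(** The determinant is symmetric in the entries of [v], so the order of the eigenvalues on the
    diagonal is irrelevant. *)
Lemma circulant_unit (K : fieldType) (eps a b c : K) (v : 'rV[K]_3) :
    1 + eps + eps ^+ 2 = 0 ->
    a + b + c != 0 -> a + b * eps + c * eps ^+ 2 != 0 -> a + b * eps ^+ 2 + c * eps != 0 ->
    perm_eq [:: v 0 0; v 0 1; v 0 ord_max] [:: a; b; c] ->
  circulant v \in unitmx.
Proof.
move=> epsE h1 h2 h3 vE; rewrite unitmxE unitfE det_circulant.
have -> : v 0 0 * v 0 1 * v 0 ord_max = a * b * c.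
  have := perm_big _ vE : \prod_(x <- _) x = \prod_(x <- _) x.
  by rewrite !big_cons !big_nil !mulr1 !mulrA.
have -> : v 0 0 ^+ 3 + v 0 1 ^+ 3 + v 0 ord_max ^+ 3 = a ^+ 3 + b ^+ 3 + c ^+ 3.
  have := perm_big _ vE : \sum_(x <- _) x ^+ 3 = \sum_(x <- _) x ^+ 3.
  by rewrite !big_cons !big_nil !addr0 !addrA.
by rewrite -opprB oppr_eq0 -(sum_cubes_factor _ _ _ _ _ epsE) !mulf_neq0.
Qed.

Lemma homog_trace0 (K : fieldType) n (d : 'I_n.+1) (A : 'M[K]_n.+1) :
  homog d A -> d != 0 -> \tr A = 0.
Proof.
by move=> Ad d0; apply: big1 => i _; rewrite Ad // -[X in X == _]addr0 (inj_eq (addrI i)) eq_sym.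
Qed.

Theorem theorem3p13 (K : closedFieldType) (eps : K)
  (heps : if 3%N \in [pchar K] then eps = 1 else 3.-primitive_root eps)
  (m : nat) (c : {perm 'I_m} -> K) (alpha beta gamma : K)
  (h1 : alpha + beta + gamma != 0)
  (h2 : alpha + beta * eps + gamma * eps ^+ 2 != 0)
  (h3 : alpha + beta * eps ^+ 2 + gamma * eps != 0)
  (e : 'I_m -> 'I_3 * 'I_3)
  (hev : char_poly (mlp_eval c (fun i => delta_mx (e i).1 (e i).2 : 'M[K]_3))
         = \prod_(a <- [:: alpha; beta; gamma]) ('X - a%:P)) :
  zariski_dense (mlp_image (n := 2) c).
Proof.
pose d i := (e i).2 - (e i).1.
pose x : {ffun 'I_m -> 'rV[K]_3} := [ffun i => delta_mx 0 (e i).1].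
have eE : mlp_eval c (fun i => delta_mx (e i).1 (e i).2 : 'M[K]_3) =
          mlp_eval c (fun i => homog_mx (d i) (x i)).
  by apply: eq_mlp_eval => i; rewrite ffunE -homog_delta_mx.
rewrite eE in hev.
have mlp_homog y : homog (\sum_i d i) (mlp_eval c (fun i => homog_mx (d i) (y i) : 'M[K]_3)).
  by apply: homog_mlp_eval => i; apply: homog_mxP.
have d0 : \sum_i d i = 0.
  apply: contraNeq h1 => d0; rewrite -(trace_eigenvalues _ _ _ _ _ hev).
  by rewrite (homog_trace0 _ _ _ _ (mlp_homog x)).
have mlp_diag (y : {ffun 'I_m -> 'rV[K]_3}) :
    mlp_eval c (fun i => homog_mx (d i) (y i)) = diag_mx (diag_eval c d y).
  by apply: homog0_diag_mx; rewrite -d0.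
rewrite mlp_diag in hev.
have vU : circulant (diag_eval c d x) \in unitmx.
  apply: circulant_unit h1 h2 h3 _; first exact: cube_root_sum.
  exact: diag_mx_eigenvalues.
(* In [zariski_dense], [A] ranges over all functions ['I_3 -> 'I_3 -> K]. *)
move=> f f0 A.
have -> : cpeval (fun ij => A ij.1 ij.2) f =
    cpeval (fun ij => (\matrix_(i, j) A i j) ij.1 ij.2) f.
  by apply: eq_cpeval => ij; rewrite mxE.
apply: eq0_of_diagonalizable => P w PU.
(* For fixed [P], the entries of [invmx P *m diag_mx u *m P] are linear forms in [u], with
   coefficients [L]. *)
pose L (ij : 'I_3 * 'I_3) := \col_k (invmx P ij.1 k * P k ij.2).
have LE u ij : (invmx P *m diag_mx u *m P) ij.1 ij.2 = (u *m L ij) 0 0.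
  rewrite !mxE; apply: eq_bigr => k _.
  by rewrite mul_mx_diag !mxE mulrAC mulrC.
rewrite (eq_cpeval _ _ _ _ _ (LE w)).
apply: (@eq0_of_multilinear _ _ _ _ _ L f (diag_eval_multilinear _ _ _ c d)) => [k H xH|y].
  (* The rows of the invertible circulant are values of [diag_eval] at shifted tuples, so they lie
     in the row space of [H]. *)
  rewrite -sub1mx -(mulVmx vU) (submx_trans (submxMl _ _)) //.
  apply/row_subP => i; rewrite (_ : row i _ = diag_eval c d [ffun j => shift_row i (x j)]) //.
  by rewrite diag_eval_shift; apply/rowP => j; rewrite !mxE.
rewrite -(eq_cpeval _ _ _ _ _ (LE _)) -mlp_diag; apply: f0.
(* The image is closed under conjugation: conjugate all arguments. *)
exists (fun i => invmx P *m homog_mx (d i) (y i) *m P).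
have [PL PM] := conj_mx_morph _ _ _ PU.
by rewrite (mlp_eval_morph _ _ _ c (fun i => homog_mx (d i) (y i)) _ PL PM).
Qed.
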